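(* Let $X$ be a vector space over $\mathbb{R}$, and let $\xi^{i}:X\rightarrow\mathbb{R}$, $i=1,\ldots,n$, be linear functionals which are linearly independent. Then there exist vectors $\varepsilon_{1},\ldots,\varepsilon_{n}$ in $X$ such that $\langle\xi^{i},\varepsilon_{j}\rangle=\delta_{j}^{i}$ for all $i,j\in\{1,\ldots,n\}$, where $\delta_{j}^{i}$ is the Kronecker delta.
   Context: For a linear functional $\xi:X\to\mathbb{R}$ and $x\in X$, $\langle\xi,x\rangle$ denotes the value $\xi(x)$. The space $X$ is an arbitrary real vector space (possibly infinite-dimensional, with no topology assumed), and linear independence of the functionals is in the space of all linear maps $X\to\mathbb{R}$. The Kronecker delta is $\delta^i_j=1$ if $i=j$ and $0$ otherwise. *)

(* Defs.v *)
From HB Require Import structures.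
From mathcomp Require Import all_boot all_order all_algebra.
From mathcomp Require Import boolp functions reals.
Set Implicit Arguments.
Unset Strict Implicit.
Unset Printing Implicit Defensive.
Import Order.TTheory GRing.Theory Num.Theory.
Local Open Scope ring_scope.

(* [free] from vector.v applies only to finite-dimensional spaces. *)
Definition linearly_independent (K : fieldType) (V : lmodType K) (n : nat)
    (v : 'I_n -> V) : Prop :=
  forall c : 'I_n -> K, \sum_(i < n) c i *: v i = 0 -> forall i, c i = 0.

(* The linear maps X -> K form a subspace of the pointwise K-module X -> K^o,
   so they are independent among linear maps iff they are so in X -> K^o. *)
Definition linearly_independent_functionals (K : fieldType) (X : lmodType K)
    (n : nat) (xi : 'I_n -> {scalar X}) : Prop :=
  @linearly_independent K (X -> K^o) n (fun i => xi i : X -> K^o).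

(* Main.v *)
Require Import Defs.
From HB Require Import structures.
From mathcomp Require Import all_boot all_order all_algebra.
From mathcomp Require Import boolp functions reals.
Set Implicit Arguments.
Unset Strict Implicit.
Unset Printing Implicit Defensive.
Import Order.TTheory GRing.Theory Num.Theory.
Local Open Scope ring_scope.

(** The evaluation vectors (xi_1 x, ..., xi_n x), for x in X, span K^n:
    otherwise they all lie in a hyperplane, and an equation of that hyperplane
    is a nontrivial linear relation between the xi_i. Hence some matrix whose
    rows are evaluation vectors has a left inverse, and the entries of this
    inverse are the coefficients of the dual vectors. *)

Section DualFamily.
Variables (K : fieldType) (X : lmodType K) (n : nat) (xi : 'I_n -> {scalar X}).

Definition eval_row (x : X) : 'rV[K]_n := \row_i xi i x.

Definition eval_mx m (x : 'I_m -> X) : 'M[K]_(m, n) :=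
  \matrix_(k, i) xi i (x k).

Hypothesis xi_indep : linearly_independent_functionals xi.

Lemma eval_row_notin m (A : 'M[K]_(m, n)) :
  (\rank A < n)%N -> exists y, ~~ (eval_row y <= A)%MS.
Proof.
move=> ltAn; apply: contrapT => /forallNP evalA.
(* A row lies in the row space of [A] iff [cokermx A] kills it, so each column of [cokermx A] lists
   the coefficients of a linear relation between the [xi i]. *)
have coker0 : cokermx A = 0.
  apply/matrixP => i j; rewrite [RHS]mxE.
  apply: (xi_indep (c := fun i => cokermx A i j)).
  apply/funext => y; rewrite fct_sumE.
  transitivity ((eval_row y *m cokermx A) 0 j).
    by rewrite [RHS]mxE; apply: eq_bigr => k _; rewrite [eval_row y 0 k]mxE mulrC.
  by have /negP := evalA y; rewrite negbK submxE => /eqP ->; rewrite [LHS]mxE.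
(* The rank of [cokermx A] is [n - \rank A], which is positive. *)
by have := mxrank_coker A; rewrite coker0 mxrank0 => /esym/eqP;
  rewrite subn_eq0 leqNgt ltAn.
Qed.

(** As long as the rank is below [n], appending an evaluation row outside the row space raises
    it. *)
Lemma eval_mx_rank r :
  (r <= n)%N -> exists m (x : 'I_m -> X), (r <= \rank (eval_mx x))%N.
Proof.
elim: r => [_|r IHr ltrn]; first by exists 0%N, (fun=> 0).
have [m [x lerx]] := IHr (ltnW ltrn).
have [ltxn|] := ltnP (\rank (eval_mx x)) n; last first.
  by move=> lenx; exists m, x; apply: leq_trans lenx.
have [y yNx] := eval_row_notin ltxn.
pose x' (k : 'I_(m + 1)) := if fintype.split k is inl j then x j else y.
exists (m + 1)%N, x'; apply: leq_ltn_trans lerx _.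
have -> : eval_mx x' = col_mx (eval_mx x) (eval_row y).
  by apply/matrixP => k i; rewrite !mxE /x'; case: fintype.split => j; rewrite mxE.
rewrite -addsmxE; apply: rank_ltmx.
rewrite /ltmx addsmxSl /=; apply: contra yNx; apply: submx_trans.
exact: addsmxSr.
Qed.

Lemma dual_family_exists :
  exists eps : 'I_n -> X, forall i j : 'I_n, xi i (eps j) = (i == j)%:R.
Proof.
have [m [x full_x]] := eval_mx_rank (leqnn n).
have {}full_x : row_full (eval_mx x) by rewrite -col_leq_rank.
(* By linearity [xi i (eps j)] is the entry [(j, i)] of [pinvmx (eval_mx x) *m eval_mx x], which is
   the identity by full column rank. *)
exists (fun j => \sum_k pinvmx (eval_mx x) j k *: x k) => i j.
have /matrixP/(_ j i) := mulVpmx full_x; rewrite [RHS]mxE eq_sym => <-.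
rewrite [RHS]mxE linear_sum; apply: eq_bigr => k _.
by rewrite linearZ [eval_mx x k i]mxE.
Qed.

End DualFamily.

Theorem theorem0p2 (R : realType) (X : lmodType R) (n : nat)
    (xi : 'I_n -> {scalar X}) (hxi : linearly_independent_functionals xi) :
  exists eps : 'I_n -> X, forall i j : 'I_n, xi i (eps j) = (i == j)%:R.
Proof. exact: dual_family_exists hxi. Qed.
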